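(* Let $A_i\in \mathsf{Mat}_{n_i \times n_i}(\mathbb{F}_{q})$, $1\leq i \leq l$, be square superregular matrices, and let $B\in \mathsf{Mat}_{n \times n}(\mathbb{F}_{q})$ be a non-singular square matrix. Then the matrix $$M = A_1\otimes A_2 \otimes \cdots \otimes A_l \otimes B$$ is an $\frac{N n}{n_1}$-block superregular matrix of size $Nn\times Nn$ over $\mathbb{F}_q$, where $N=\prod_{i=1}^{l}n_i$.
   Context: $\mathbb{F}_q$ is the finite field with $q$ elements, $q$ a prime power; $l\ge 1$ is an integer. A matrix over a field is superregular if every square submatrix of it (of any size, obtained by choosing arbitrary rows and equally many arbitrary columns) is non-singular. A matrix $A=[A_{ij}]\in \mathsf{Mat}_{bm\times bt}(\mathbb{F}_q)$, partitioned into blocks $A_{ij}$ of size $b\times b$, is $b$-block superregular if every square submatrix consisting of full blocks $A_{ij}$ (i.e. obtained by choosing some block rows and equally many block columns) is non-singular over $\mathbb{F}_q$. $A\otimes B$ is the Kronecker product, i.e. the block matrix whose $(i,j)$ block is $a_{ij}B$. *)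

(* Defs.v *)
From mathcomp Require Import all_boot all_algebra.
From mathcomp Require Export mxtens.

Set Implicit Arguments.
Unset Strict Implicit.
Unset Printing Implicit Defensive.

Local Open Scope ring_scope.

Definition superregular (F : fieldType) (p q : nat) (A : 'M[F]_(p, q)) : Prop :=
  forall (k : nat) (f : 'I_k -> 'I_p) (g : 'I_k -> 'I_q),
    {homo f : i j / (i < j)%N} -> {homo g : i j / (i < j)%N} ->
    mxsub f g A \in unitmx.

(* When b divides p, {0, ..., p-1} splits into p %/ b consecutive blocks of
   size b. The selection f of k of these blocks lists k * b indices: the r-th
   one in the i-th selected block, at position i * b + r, is f i * b + r. *)
Definition block_index (b p k : nat) (f : 'I_k -> 'I_(p %/ b))
    (x : 'I_(k * b)) : 'I_p :=
  widen_ord (leq_divM p b)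
    (mxtens_index (f (mxtens_unindex x).1, (mxtens_unindex x).2)).

Definition block_superregular (F : fieldType) (b p q : nat)
    (A : 'M[F]_(p, q)) : Prop :=
  [/\ (b %| p)%N, (b %| q)%N &
    forall (k : nat) (f : 'I_k -> 'I_(p %/ b)) (g : 'I_k -> 'I_(q %/ b)),
      {homo f : i j / (i < j)%N} -> {homo g : i j / (i < j)%N} ->
      mxsub (block_index f) (block_index g) A \in unitmx].

Lemma prod0_mul (n : 'I_0 -> nat) (m : nat) : m = (\prod_(i < 0) n i * m)%N.
Proof. by rewrite big_ord0 mul1n. Qed.

Lemma prodS_mul (l : nat) (n : 'I_l.+1 -> nat) (m : nat) :
  (n ord0 * (\prod_(i < l) n (lift ord0 i) * m) = \prod_(i < l.+1) n i * m)%N.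
Proof. by rewrite big_ord_recl mulnA. Qed.

(* A_0 ⊗ (A_1 ⊗ (... ⊗ (A_(l-1) ⊗ B))); the casts only rewrite the sizes. *)
Fixpoint tensmx_seq (R : pzRingType) (l : nat) :
    forall (n : 'I_l -> nat), (forall i, 'M[R]_(n i)) ->
    forall m : nat, 'M[R]_m -> 'M[R]_(\prod_(i < l) n i * m) :=
  match l with
  | 0 => fun n _ m B => castmx (prod0_mul n m, prod0_mul n m) B
  | l'.+1 => fun n A m B =>
      castmx (prodS_mul n m, prodS_mul n m)
        (tensmx (A ord0) (tensmx_seq (fun i => A (lift ord0 i)) B))
  end.

(* Main.v *)
Require Import Defs.
From mathcomp Require Import all_boot all_algebra.

(** Group the product as M = A_1 ⊗ C, where C = A_2 ⊗ ... ⊗ A_l ⊗ B has size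
    N n / n_1.  The blocks of M of that size are the a_ij C with a_ij the
    entries of A_1, so a submatrix of M made of full blocks is S ⊗ C, where S
    is the corresponding square submatrix of A_1 ([mxsub_block_tensmx]).
    A Kronecker product of non-singular matrices is non-singular.  Here S is
    non-singular because A_1 is superregular, and C is non-singular because
    each of A_2, ..., A_l is a square submatrix of itself and B is
    non-singular ([tensmx_seq_unitmx]). *)

Local Open Scope ring_scope.

Lemma castmx_unitmx (R : comUnitRingType) (m n : nat) (e : m = n) (A : 'M[R]_m) :
  (castmx (e, e) A \in unitmx) = (A \in unitmx).
Proof. by case: n / e; rewrite castmx_id. Qed.

Lemma superregular_unitmx (F : fieldType) (n : nat) (A : 'M[F]_n) :
  superregular A -> A \in unitmx.
Proof.
move=> regA; have <- : mxsub id id A = A by apply/matrixP=> i j; rewrite mxE.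
exact: regA.
Qed.

Lemma tensmx_seq_unitmx (F : fieldType) (l : nat) (ni : 'I_l -> nat)
    (A : forall i, 'M[F]_(ni i)) (n : nat) (B : 'M[F]_n) :
  (forall i, (0 < ni i)%N) -> (0 < n)%N ->
  (forall i, A i \in unitmx) -> B \in unitmx -> tensmx_seq A B \in unitmx.
Proof.
move=> + n_gt0 + uB; elim: l => [|l IHl] in ni A * => ni_gt0 uA /=.
  by rewrite castmx_unitmx.
rewrite castmx_unitmx; apply: tensmx_unit (uA _) (IHl _ _ _ _) => //.
  by rewrite -lt0n.
by rewrite -lt0n muln_gt0 n_gt0 andbT prodn_gt0.
Qed.

(** Both sides pair the block index with the offset inside the block, which
    is also how [tensmx] indexes its rows and columns.  The cast expresses that a matrix with p * m rows has p block rows of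
    height m. *)
Lemma mxsub_block_tensmx (R : pzRingType) (p q m k : nat) (m_gt0 : (0 < m)%N)
    (A : 'M[R]_(p, q)) (C : 'M[R]_m)
    (f : 'I_k -> 'I_(p * m %/ m)) (g : 'I_k -> 'I_(q * m %/ m)) :
  mxsub (block_index f) (block_index g) (tensmx A C) =
  tensmx (mxsub (cast_ord (mulnK p m_gt0) \o f)
                (cast_ord (mulnK q m_gt0) \o g) A) C.
Proof.
have unindexE r (h : 'I_k -> 'I_(r * m %/ m)) x :
    mxtens_unindex (block_index h x) =
    (cast_ord (mulnK r m_gt0) (h (mxtens_unindex x).1), (mxtens_unindex x).2).
  rewrite -[RHS]mxtens_indexK; congr mxtens_unindex; exact: val_inj.
by apply/matrixP=> x y; rewrite !mxE !unindexE.
Qed.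

Lemma tensmx_block_superregular (F : fieldType) (p q m : nat)
    (A : 'M[F]_(p, q)) (C : 'M[F]_m) :
  (0 < m)%N -> superregular A -> C \in unitmx ->
  block_superregular m (tensmx A C).
Proof.
move=> m_gt0 regA uC; split; rewrite ?dvdn_mull // => k f g incf incg.
rewrite mxsub_block_tensmx.
(* The empty selection gives a matrix of size 0, whose determinant is 1. *)
case: k => [|k] in f g incf incg *; first by rewrite unitmxE det_mx00 GRing.unitr1.
apply: tensmx_unit uC; rewrite -?lt0n //.
by apply: regA => i j ij; [apply: incf | apply: incg].
Qed.

Lemma castmx_block_superregular (F : fieldType) (b m n : nat) (e : m = n)
    (A : 'M[F]_m) :
  block_superregular b A -> block_superregular b (castmx (e, e) A).
Proof. by case: n / e; rewrite castmx_id. Qed.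

Theorem theorem4 (F : finFieldType) (l : nat) (hl : (0 < l)%N)
    (ni : 'I_l -> nat) (hni : forall i, (0 < ni i)%N)
    (A : forall i, 'M[F]_(ni i)) (hA : forall i, superregular (A i))
    (n : nat) (hn : (0 < n)%N) (B : 'M[F]_n) (hB : B \in unitmx) :
  let N := (\prod_(i < l) ni i)%N in
  let n1 := ni (Ordinal hl) in
  let M : 'M[F]_(N * n) := tensmx_seq A B in
  block_superregular ((N * n) %/ n1)%N M.
Proof.
case: l => [|l] in hl ni hni A hA * => //=.
have -> : Ordinal hl = ord0 by apply: val_inj.
rewrite -[in X in block_superregular X](prodS_mul ni n) mulKn //.
apply/castmx_block_superregular/tensmx_block_superregular => //.
  by rewrite muln_gt0 hn andbT prodn_gt0.
by apply: tensmx_seq_unitmx => // i; apply: superregular_unitmx.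
Qed.
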